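(* Let $S$ be a smooth projective algebraic surface over an algebraically closed field, with Picard number $\rho(S)$. Then: (1) $mv(S) = 3$ if and only if $\rho(S) = 1$. (2) $mv(S) = 4$ if and only if $\rho(S) > 1$ and there are no negative irreducible curves on $S$. (3) If $S$ contains some negative irreducible curve, then $mv(S) = 5$ if and only if $\rho(S) = 2$.
   Context: Surfaces are irreducible. $\rho = \rho(S)$ is the Picard number, i.e. the rank of the Néron–Severi group $\mathrm{NS}(S)$. A negative irreducible curve on $S$ is an irreducible curve $C \subset S$ with $C^2 < 0$. Definition of $mv(S)$. Let $N = C_1 + \cdots + C_k$ be a sum of $k \ge 0$ distinct irreducible curves on $S$ whose intersection matrix $(C_i\cdot C_j)$ is negative definite (the empty sum, $k=0$, is allowed; necessarily $k \le \rho-1$). Let $mc(N)$ be the largest number of irreducible components of a connected divisor contained in $N$ (so $mc(N)=0$ if $k=0$). Put $$mv(N) = \begin{cases} k + mc(N) + 4, & \text{if } k < \rho - 1,\\ k + mc(N) + 3, & \text{if } k = \rho - 1,\end{cases}$$ and $mv(S) = \max\{mv(N)\}$, the maximum over all such $N$. Meaning of $mv(S)$. An admissible flag on $S$ is $Y_\bullet: S \supset C \supset \{p\}$ with $C$ a smooth irreducible curve and $p\in C$ a point. For a big divisor $D$ and a nonzero section $s \in H^0(S,\mathcal{O}_S(D))$ put $\nu_1(s) = \mathrm{ord}_C(s)$ and let $\nu_2(s)$ be the order of vanishing at $p$ of the nonzero restriction to $C$ of the section of $\mathcal{O}_S(D-\nu_1(s)C)$ induced by $s$; let $\nu(D) \subset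 \mathbb{Z}^2$ be the set of all vectors $(\nu_1(s),\nu_2(s))$. The Newton–Okounkov body $\Delta_{Y_\bullet}(D)$ is the closed convex hull of $\bigcup_{m\ge1}\frac1m\nu(mD)$ in $\mathbb{R}^2$; it is a polygon. By a known theorem of Roé and Szemberg, for every ample divisor $D$ on $S$ the maximum over admissible flags $Y_\bullet$ of the number of vertices of $\Delta_{Y_\bullet}(D)$ equals $mv(S)$ (and for every big $D$ it is at most $mv(S)$). *)

(* Defs.v *)
From HB Require Import structures.
From mathcomp Require Import all_boot all_order all_algebra.
From mathcomp Require Import boolp classical_sets constructive_ereal.
From mathcomp Require Import topology_structure connected.
(* The notations of mpoly clash with those of topology_structure. *)
From mathcomp Require Import -(notations) mpoly.
From mathcomp Require Import freeg.

Set Implicit Arguments.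
Unset Strict Implicit.
Unset Printing Implicit Defensive.

Import Order.TTheory GRing.Theory Num.Theory.

Local Open Scope classical_set_scope.
Local Open Scope ring_scope.

Notation "{ 'mpoly' T [ n ] }" := (mpoly.mpoly n T) : type_scope.

Section ProjectiveSpace.
Variables (k : closedFieldType) (n : nat).

Notation R := {mpoly k[n.+1]}.

Definition ideal_add (I J : {pred R}) : {pred R} :=
  [pred h | `[< exists f g : R, [/\ f \in I, g \in J & h = f + g] >]].

Definition ideal_mul (I J : {pred R}) : {pred R} :=
  [pred h | `[< exists s : seq (R * R),
    (forall p, p \in s -> p.1 \in I /\ p.2 \in J) /\
    h = \sum_(p <- s) p.1 * p.2 >]].

(* Points of the scheme Proj k[x_0, ..., x_n]: homogeneous prime ideals not
   containing the irrelevant ideal.  The point x stands for the integral closed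
   subvariety {x}^- of P^n, whose homogeneous ideal is x. *)
Record proj_pt := ProjPt {
  pt_ideal :> prime_idealr R;
  pt_homog : forall (d : nat) (f : R),
    f \in (pt_ideal : {pred R}) -> pihomog mdeg d f \in (pt_ideal : {pred R});
  pt_relevant : exists i : 'I_n.+1, mpolyX k (mnm1 i) \notin (pt_ideal : {pred R}) }.

HB.instance Definition _ := gen_eqMixin proj_pt.
HB.instance Definition _ := gen_choiceMixin proj_pt.

Definition zeros (J : {pred R}) : set proj_pt :=
  [set x | {subset J <= (x : {pred R})}].

Definition zariski_open (U : set proj_pt) : Prop :=
  exists J : {pred R}, ~` U = zeros J.

Lemma zariski_openT : zariski_open setT.
Proof.
exists (xpredT : {pred R}); rewrite setCT; apply/seteqP; split=> // x /(_ 1 isT).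
by rewrite (idealr1 x).
Qed.

Lemma zariski_openI : setI_closed zariski_open.
Proof.
move=> U V [J UJ] [K VK]; exists (ideal_mul J K).
rewrite setCI UJ VK; apply/seteqP; split=> x.
  move=> xJK h /asboolP[s [sJK ->]].
  rewrite big_seq; apply: rpred_sum => p /sJK[pJ pK].
  by case: xJK => [/(_ _ pJ)|/(_ _ pK)] px; rewrite prime_idealrM px ?orbT.
move=> xJK; apply: contrapT => /not_orP[nJ nK].
have [f fJ nf] : exists2 f : R, f \in J & f \notin (x : {pred R}).
  apply: contrapT => h; apply: nJ => f fJ; apply/negPn/negP => nf.
  by apply: h; exists f.
have [g gK ng] : exists2 g : R, g \in K & g \notin (x : {pred R}).
  apply: contrapT => h; apply: nK => g gK; apply/negPn/negP => ng.
  by apply: h; exists g.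
have /xJK : f * g \in ideal_mul J K.
  apply/asboolP; exists [:: (f, g)]; rewrite big_seq1; split=> // p.
  by rewrite mem_seq1 => /eqP->.
by rewrite prime_idealrM (negbTE nf) (negbTE ng).
Qed.

Lemma zariski_open_bigU (I : Type) (U : I -> set proj_pt) :
  (forall i, zariski_open (U i)) -> zariski_open (\bigcup_i U i).
Proof.
move=> /choice[J UJ].
pose K : {pred R} := [pred f | `[< exists i, f \in J i >]].
exists K; rewrite setC_bigcup; apply/seteqP; split=> x.
  move=> xU f /asboolP[i fJ].
  by have := xU i Logic.I; rewrite UJ; apply.
move=> xJ i _; rewrite UJ => f fJ; apply: xJ.
by apply/asboolP; exists i.
Qed.

HB.instance Definition _ := isOpenTopological.Build proj_pt
  zariski_openT zariski_openI zariski_open_bigU.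

Definition variety (x : proj_pt) : set proj_pt := zeros x.

(* [sub_variety x y]: the variety of y is strictly contained in that of x. *)
Definition sub_variety : rel proj_pt :=
  fun x y => `[< variety y `<` variety x >].

(* Krull dimension: d is the maximal length of a chain of integral closed
   subvarieties strictly decreasing from the variety of x. *)
Definition dimension_is (x : proj_pt) (d : nat) : Prop :=
  (exists s : seq proj_pt, path sub_variety x s /\ size s = d) /\
  (forall s : seq proj_pt, path sub_variety x s -> (size s <= d)%N).

(* Jacobian criterion at the closed points of the variety of x, in homogeneous
   coordinates; d is the dimension of the variety. *)
Definition smooth (x : proj_pt) (d : nat) : Prop :=
  forall v : 'rV[k]_n.+1, v != 0 ->
    (forall f : R, f \in (x : {pred R}) -> meval (v 0) f = 0) ->
  exists (m : nat) (f : 'I_m -> R),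
    (forall i, f i \in (x : {pred R})) /\
    \rank (\matrix_(i < m, j < n.+1) meval (v 0) (mderiv j (f i))) = (n - d)%N.

Definition graded_piece (J : {pred R}) (d : nat) : {vspace dhomog n.+1 k d} :=
  xget 0%VS [set U | forall f : dhomog n.+1 k d,
    (f \in U) = (mpoly_of_dhomog f \in J)].

Definition hilbert_function (J : {pred R}) (d : nat) : nat :=
  (\dim (fullv : {vspace dhomog n.+1 k d}) - \dim (graded_piece J d))%N.

Definition hilbert_polynomial (J : {pred R}) : {poly rat} :=
  xget 0 [set P : {poly rat} | exists d0 : nat, forall d : nat, (d0 <= d)%N ->
    P.[d%:R] = (hilbert_function J d)%:R].

(* The Euler characteristic of the structure sheaf of the closed subscheme
   Proj (R / J) of P^n, J a homogeneous ideal. *)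
Definition euler_char (J : {pred R}) : rat := (hilbert_polynomial J).[0].

End ProjectiveSpace.

Record surface (k : closedFieldType) (n : nat) := Surface {
  surf_pt :> proj_pt k n;
  surf_dim : dimension_is surf_pt 2;
  surf_smooth : smooth surf_pt 2 }.

Record curve (k : closedFieldType) (n : nat) (S : surface k n) := Curve {
  curve_pt :> proj_pt k n;
  curve_sub : variety curve_pt `<=` variety S;
  curve_dim : dimension_is curve_pt 1 }.

HB.instance Definition _ k n (S : surface k n) := gen_eqMixin (curve S).
HB.instance Definition _ k n (S : surface k n) := gen_choiceMixin (curve S).

Section Surface.
Variables (k : closedFieldType) (n : nat) (S : surface k n).

Notation R := {mpoly k[n.+1]}.

(* For C <> D, C.D is the length of the scheme-theoretic intersection of C and
   D, i.e. the sum over its points p of dim O_{S,p}/(f,g), with f and g local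
   equations of C and D.  The self-intersection C^2 is the degree of the normal
   bundle of C in S, that is
     - deg (I/I^2) = chi(O_C) - chi(I/I^2) = 2 chi(O_C) - chi(O_S/I^2)
   where I is the ideal sheaf of C in O_S. *)
Definition intersection (C D : curve S) : rat :=
  if C == D then
    2 * euler_char (C : {pred R}) - euler_char (ideal_add (ideal_mul C C) S)
  else euler_char (ideal_add C D).

Definition negative_curve (C : curve S) : Prop := intersection C C < 0.

Definition divisor := {freeg (curve S) / int}.

Definition divisor_dot (D : divisor) (C : curve S) : rat :=
  fglift (fun X : curve S => intersection X C : zmodule rat) D.

Definition num_trivial : {pred divisor} :=
  [pred D | `[< forall C : curve S, divisor_dot D C = 0 >]].

Lemma num_trivial_zmod_closed : zmod_closed num_trivial.
Proof.
have dotB C : {morph divisor_dot^~ C : D E / D - E}.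
  exact: (@lift_is_additive int (curve S) (zmodule rat)).
split=> [|D E /asboolP D0 /asboolP E0]; apply/asboolP=> C.
  by rewrite -(subrr 0) dotB subrr.
by rewrite dotB D0 E0 subrr.
Qed.

HB.instance Definition _ :=
  GRing.isZmodClosed.Build divisor num_trivial num_trivial_zmod_closed.

(* The Neron-Severi group N^1(S) = Div(S)/Num(S), numerical classes of divisors.
   Dividing by algebraic equivalence instead only adds torsion. *)
Definition neron_severi : zmodType := Quotient.quot num_trivial.

End Surface.

Definition Zfree (A : zmodType) (r : nat) (a : 'I_r -> A) : Prop :=
  forall c : 'I_r -> int, \sum_i a i *~ c i = 0 -> forall i, c i = 0.

(* The rank of A, +oo if there is no bound on the size of free families. *)
Definition Zrank (A : zmodType) : \bar int :=
  xget +oo%E [set r%:Z%:E | r in [set r : nat |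
    (exists a : 'I_r -> A, Zfree a) /\
    forall (m : nat) (a : 'I_m -> A), Zfree a -> (m <= r)%N]].

Definition picard_number k n (S : surface k n) : \bar int :=
  Zrank (neron_severi S).

Section MaxVertices.
Variables (k : closedFieldType) (n : nat) (S : surface k n).

Section Config.
Variables (r : nat) (C : 'I_r -> curve S).

Definition intersection_matrix : 'M[rat]_r :=
  \matrix_(i, j) intersection (C i) (C j).

(* N = C_0 + ... + C_{r-1}.  As the matrix is rational, definiteness over rat is
   the same as over the reals. *)
Definition negative_configuration : Prop :=
  injective C /\
  forall v : 'rV[rat]_r, v != 0 -> (v *m intersection_matrix *m v^T) 0 0 < 0.

(* The set A stands for the divisor \sum_(i in A) C_i contained in N. *)
Definition mc : nat :=
  \max_(A : {set 'I_r} | `[< connected (\bigcup_(i in [set` A]) variety (C i)) >])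
    #|A|.

(* A negative definite configuration has r <= picard_number S - 1. *)
Definition mvN : nat :=
  (r + mc + if (r%:Z%:E < picard_number S - 1%:E)%E then 4 else 3)%N.

End Config.

Definition mv : nat :=
  xget 0%N [set m |
    (exists (r : nat) (C : 'I_r -> curve S),
       negative_configuration C /\ m = mvN C) /\
    forall (r : nat) (C : 'I_r -> curve S),
      negative_configuration C -> (mvN C <= m)%N].

End MaxVertices.

(* Main.v *)
(* A negative definite configuration C_1, ..., C_r satisfies r <= rho - 1: as
   distinct curves have nonnegative intersection, the classes of C_1, ..., C_r
   and D are independent for any curve D such that D.E > 0 for some other curve
   E, with D and E outside of {C_1, ..., C_r}.  All three parts follow from this
   bound for r <= 2 and from the value of mv(N) for N empty or one curve.

   Everything geometric is read off the Hilbert function h_J of a homogeneous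
   ideal J, through h_J(d + e) = h_(J + (a))(d + e) + h_(J : a)(d) for a form a
   of degree e, which replaces dimension theory.  By Noetherian induction it
   reduces h_J to primes; it gives h = 1 at closed points, hence D.E is the
   limit of a Hilbert function, positive if D and E meet; and it shows that a
   hyperplane section of S contains a curve.  Each member of a pencil of
   hyperplane sections with finite base locus on S contains a curve meeting that
   base locus, so two curves outside of any given finite set meet. *)

Require Import Defs.
From HB Require Import structures.
From mathcomp Require Import all_boot all_order all_algebra.
From mathcomp Require Import boolp classical_sets constructive_ereal.
From mathcomp Require Import topology_structure connected.
From mathcomp Require Import -(notations) mpoly.
From mathcomp Require Import freeg.
From mathcomp Require Import ring_quotient zify.

Set Implicit Arguments.
Unset Strict Implicit.
Unset Printing Implicit Defensive.

Import Order.TTheory GRing.Theory Num.Theory.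

Local Open Scope ring_scope.

(** * Noetherianity of homogeneous ideals *)

(** Every tail of [u] attains its minimum; each chosen index attains the minimum of the tail beyond
    the previous one. *)
Lemma nondecreasing_subseq (u : nat -> nat) :
  exists2 f : nat -> nat, {homo f : i j / (i < j)%N} &
    {homo u \o f : i j / (i <= j)%N}.
Proof.
have /choice[F HF] : forall N, exists a, (N <= a)%N /\
    forall b, (N <= b)%N -> (u a <= u b)%N.
  move=> N.
  have ex : exists v, `[< exists2 a, (N <= a)%N & u a = v >].
    by exists (u N); apply/asboolP; exists N.
  case: (ex_minnP ex) => v /asboolP[a Na <-] minv.
  exists a; split=> // b Nb; apply: minv; apply/asboolP; by exists b.
pose f := fix f k := if k is k'.+1 then F (f k').+1 else F 0%N.
have fS k : (f k < f k.+1)%N by rewrite /=; case: (HF (f k).+1).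
have fmin k b : (f k <= b)%N -> (u (f k) <= u b)%N.
  move=> kb; case: k kb => [|k] kb /=; first by case: (HF 0%N) => _; apply.
  by case: (HF (f k).+1) => le; apply; apply: leq_trans kb;
    apply: leq_trans le _.
have fincr : {homo f : i j / (i < j)%N}.
  exact: (homo_ltn ltn_trans).
exists f => // i j; rewrite leq_eqVlt => /predU1P[->//|/fincr/ltnW].
exact: fmin.
Qed.

(** Passing to a nondecreasing subsequence for one exponent after the other makes all exponents
    nondecreasing at once. *)
Lemma dickson n (m : nat -> multinom n) :
  exists i j, (i < j)%N /\ lem (m i) (m j).
Proof.
suff: forall s : seq 'I_n, exists2 f : nat -> nat, {homo f : i j / (i < j)%N} &
    forall t, t \in s -> {homo (fun i => m (f i) t) : i j / (i <= j)%N}.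
  case/(_ (enum 'I_n)) => f fincr fmono; exists (f 0%N), (f 1%N).
  split; first exact: fincr.
  by apply/mnm_lepP => t; apply: (fmono t) => //; rewrite mem_enum.
elim=> [|t s [f fincr fmono]]; first by exists id.
have [g gincr gmono] := nondecreasing_subseq (fun i => m (f i) t).
exists (f \o g) => [i j ij|t']; first exact/fincr/gincr.
rewrite inE => /predU1P[->|/fmono ft] i j ij; first exact: gmono.
apply: ft; move: ij; rewrite leq_eqVlt => /predU1P[->//|/gincr/ltnW//].
Qed.

Section Surfaces.
Variables (k : closedFieldType) (n : nat).

Notation R := {mpoly k[n.+1]}.
Notation homogeneous d := (@ishomog1 n.+1 k d mdeg).

Implicit Types (I J K : {pred R}) (x y : proj_pt k n).

Definition homog_ideal J := [/\ 0 \in J,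
  {in J &, forall f g, f + g \in J},
  forall f, {in J, forall g, f * g \in J} &
  forall d, {in J, forall f, pihomog mdeg d f \in J}].

(* Hilbert's basis theorem, from Dickson's lemma: the leading monomials of
   elements f_i of J_{i+1} outside of J_i, chosen with minimal leading monomial,
   would form an antichain. *)
Lemma homog_ideal_noetherian (P : {pred R} -> Prop) :
  (forall J, homog_ideal J ->
     (forall K, homog_ideal K -> {subset J <= K} -> ~ {subset K <= J} -> P K) ->
     P J) ->
  forall J, homog_ideal J -> P J.
Proof.
move=> IH J0 idJ0; apply: contrapT => nPJ0.
pose T := {J : {pred R} | homog_ideal J /\ ~ P J}.
have /choice[F HF] : forall J : T, exists K : T,
    {subset sval J <= sval K} /\ ~ {subset sval K <= sval J}.
  move=> [J [idJ nPJ]]; apply: contrapT => nK; apply: (nPJ);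
    apply: IH => // K idK JK nKJ.
  by apply: contrapT => nPK; apply: nK; exists (exist _ K (conj idK nPK)).
pose C i := sval (iter i F (exist _ J0 (conj idJ0 nPJ0))).
have idC i : homog_ideal (C i) by rewrite /C; case: (iter _ _ _) => ? [].
have CS i : {subset C i <= C i.+1} by case: (HF (iter i F (exist _ J0 (conj idJ0
  nPJ0)))).
have Cle i j : (i <= j)%N -> {subset C i <= C j}.
  by move=> /subnKC<-; elim: (j - i)%N => [|l ih] f;
    rewrite ?addn0// addnS => /ih/CS.
have /choice[f Hf] : forall i, exists f, [/\ f \in C i.+1, f \notin C i &
    forall g, g \in C i.+1 -> g \notin C i -> ~~ (mlead g < mlead f)%O].
  move=> i; apply: contrapT => nf.
  suff H : forall m g, mlead g = m -> g \in C i.+1 -> g \in C i.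
    by case: (HF (iter i F (exist _ J0 (conj idJ0 nPJ0)))) => _; apply => g;
      exact: H.
  elim/(@ltmwf n.+1) => m ih g gm gC; apply/negPn/negP => ngC; apply: nf.
  exists g; split=> // h hC nhC; apply/negP; rewrite gm => lt;
    have := ih _ lt h erefl hC.
  by rewrite (negbTE nhC).
have [i [j [ij mle]]] := dickson (fun i => mlead (f i)).
have [fi nfi _] := Hf i; have [fj nfj minj] := Hf j.
have nz_fi : f i != 0 by apply: contraNneq nfi => ->; case: (idC i).
have nz_ci : mleadc (f i) != 0 by rewrite mleadc_eq0.
pose a := mleadc (f j) / mleadc (f i).
(* [h] is the multiple of [f i] with the leading term of [f j], so [f j - h] lies in [C j.+1]
   outside of [C j] and has a smaller leading monomial. *)
pose h := a *: mpolyX k (mnm_sub (mlead (f j)) (mlead (f i))) * f i.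
have hC : h \in C j by case: (idC j) => _ _ mulC _; apply: mulC; apply: Cle fi.
pose g := f j - h.
have hCN : - h \in C j by rewrite -mulN1r; case: (idC j) => _ _ mulC _;
  apply: mulC.
have nz_fj : f j != 0 by apply: contraNneq nfj => ->; case: (idC j).
have nz_a : a != 0 by rewrite mulf_neq0 ?invr_eq0 // mleadc_eq0.
have lmX : mlead (a *: mpolyX k (mnm_sub (mlead (f j)) (mlead (f i)))) =
  (mnm_sub (mlead (f j)) (mlead (f i))).
  by rewrite mleadZ // mleadXm.
have nzX : a *: mpolyX k (mnm_sub (mlead (f j)) (mlead (f i))) != 0.
  by rewrite -mleadc_eq0 mleadcZE mulf_neq0 // mleadXm mcoeffX eqxx oner_eq0.
have lmh : mlead h = mlead (f j) by rewrite mleadM // lmX submK.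
have gC1 : g \in C j.+1 by case: (idC j.+1) => _ addC _ _; apply: addC => //;
  apply: CS.
have ngC : g \notin C j.
  apply: contraNN nfj => gC; rewrite -[f j](subrK h).
  by case: (idC j) => _ addC _ _; apply: addC.
have /negP := minj _ gC1 ngC; apply.
have nz_g : g != 0 by apply: contraNneq ngC => ->; case: (idC j).
rewrite lt_neqAle; apply/andP; split; last first.
  by apply: le_trans (mleadB_le _ _) _; rewrite lmh joinxx.
apply: contraNneq nz_g => gm; rewrite -mleadc_eq0 gm mcoeffB.
suff -> : mcoeff (mlead (f j)) h = mleadc (f j) by rewrite subrr.
rewrite -lmh /h mleadM // mleadcM lmX mcoeffZ mcoeffX eqxx mulr1.
by rewrite submK // /a divfK.
Qed.

(** * Hilbert functions *)

(** A subspace of largest dimension inside [P] is all of [P], since any further vector of [P] would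
    enlarge it. *)
Lemma subspace_of_pred (V : vectType k) (P : {pred V}) :
  submod_closed P -> exists U : {vspace V}, U =i P.
Proof.
move=> [P0 Plin].
have PD u v : u \in P -> v \in P -> u + v \in P by move=> uP;
  rewrite -[u]scale1r; apply: Plin.
have PZ a v : v \in P -> a *: v \in P by move=> vP; rewrite -[_ *: _]addr0;
  apply: Plin.
pose Q d := `[< exists U : {vspace V}, \dim U = d /\ {subset U <= P} >].
have exQ : exists d, Q d.
  exists 0%N; apply/asboolP; exists 0%VS; rewrite dimv0; split=> // v.
  by rewrite memv0 => /eqP->.
have Qb d : Q d -> (d <= \dim {:V})%N.
  by move=> /asboolP[U [<- _]]; apply/dimvS/subvf.
case: (ex_maxnP exQ Qb) => d /asboolP[U [dU UP]] maxd.
exists U => v; apply/idP/idP=> [/UP//|vP]; apply: contraT => nvU.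
have /maxd : Q (\dim (U + <[v]>)%VS).
  apply/asboolP; exists (U + <[v]>)%VS; split=> // _ /memv_addP[u uU [w
    /vlineP[a ->] ->]].
  by apply: PD; [exact: UP|exact: PZ].
rewrite -dU leqNgt ltn_neqAle dimvS ?addvSl// andbT negbK => /eqP eqd.
have /eqP : (U == U + <[v]>)%VS by rewrite eqEdim addvSl -eqd /=.
by move=> eU; move: nvU; rewrite eU (subvP (addvSr U <[v]>%VS)) ?memv_line.
Qed.

Lemma pihomogM_ge d e (f a : R) : a \is homogeneous e ->
  pihomog mdeg (d + e) (f * a) = pihomog mdeg d f * a.
Proof.
move=> ha; rewrite [f]mpolyE mulr_suml !raddf_sum mulr_suml /=;
  apply: eq_bigr => m _.
rewrite -scalerAl !linearZ /= -scalerAl; congr (_ *: _); rewrite pihomogX.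
have hXa : mpolyX k m * a \is homogeneous (mdeg m + e).
  by apply: dhomogM => //; rewrite dhomogX.
case: eqP => [<-|/eqP ne]; first by rewrite pihomog_dE.
by rewrite mul0r (pihomog_ne0 _ hXa) // eqn_add2r.
Qed.

Lemma pihomogM_lt d e (f a : R) : a \is homogeneous e -> (d < e)%N ->
  pihomog mdeg d (f * a) = 0.
Proof.
move=> ha de; rewrite [f]mpolyE mulr_suml raddf_sum big1//= => m _.
rewrite -scalerAl linearZ /=.
have hXa : mpolyX k m * a \is homogeneous (mdeg m + e).
  by apply: dhomogM => //; rewrite dhomogX.
by rewrite (pihomog_ne0 _ hXa) ?scaler0 //; lia.
Qed.

Definition ideal_add1 J (a : R) : {pred R} :=
  [pred h | `[< exists f g : R, f \in J /\ h = f + g * a >]].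

Definition ideal_colon J (a : R) : {pred R} := [pred h | h * a \in J].

Lemma homog_ideal_add1 J a e : homog_ideal J -> a \is homogeneous e ->
  homog_ideal (ideal_add1 J a).
Proof.
move=> [J0 JD JM JH] ha; split.
- by apply/asboolP; exists 0, 0; rewrite mul0r addr0.
- move=> _ _ /asboolP[f [g [fJ ->]]] /asboolP[f' [g' [fJ' ->]]].
  by apply/asboolP; exists (f + f'), (g + g'); rewrite mulrDl addrACA;
    split=> //; apply: JD.
- move=> c _ /asboolP[f [g [fJ ->]]]; apply/asboolP; exists (c * f), (c * g).
  by rewrite mulrDr mulrA; split=> //; apply: JM.
- move=> d _ /asboolP[f [g [fJ ->]]]; apply/asboolP; exists (pihomog mdeg d f).
  have [le_ed|lt_de] := leqP e d.
    exists (pihomog mdeg (d - e) g); split; first exact: JH.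
    by rewrite raddfD /= -{2}(subnK le_ed) pihomogM_ge.
  exists 0; split; first exact: JH.
  by rewrite raddfD /= (pihomogM_lt _ ha lt_de) mul0r.
Qed.

Lemma homog_ideal_colon J a e : homog_ideal J -> a \is homogeneous e ->
  homog_ideal (ideal_colon J a).
Proof.
move=> [J0 JD JM JH] ha; split.
- by rewrite inE mul0r.
- by move=> f g fJ gJ; rewrite inE mulrDl; apply: JD.
- by move=> f g gJ; rewrite inE -mulrA; apply: JM.
- by move=> d f fJ; rewrite inE -(pihomogM_ge _ _ ha); apply: JH.
Qed.

(** The degree [d] part of [J] is stable under linear combinations, so the subspace sought exists
    and [xget] does not fall back to its default [0]. *)
Lemma graded_pieceE J d : homog_ideal J ->
  forall f : dhomog n.+1 k d, (f \in graded_piece J d) = (mpoly_of_dhomog f \in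
    J).
Proof.
move=> [J0 JD JM _].
have [|U UJ] := @subspace_of_pred (dhomog n.+1 k d) [pred f | mpoly_of_dhomog f
  \in J].
  split; first by rewrite inE linear0.
  move=> c f g fJ gJ; rewrite inE linearP /=; apply: JD => //.
  by rewrite -mul_mpolyC; apply: JM.
rewrite /graded_piece; case: xgetP => [V _ //|/(_ U)[]].
by move=> f; rewrite UJ.
Qed.

Lemma hilbert_function_subset J K d : homog_ideal J -> homog_ideal K ->
  {subset J <= K} -> (hilbert_function K d <= hilbert_function J d)%N.
Proof.
move=> idJ idK JK; apply/leq_sub2l/dimvS/subvP => f.
by rewrite !graded_pieceE // => /JK.
Qed.

(* From the exact sequence 0 -> R/(J:a)(-e) -> R/J -> R/(J + (a)) -> 0. *)
Lemma hilbert_function_add1 J a d e : homog_ideal J -> a \is homogeneous e ->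
  hilbert_function J (d + e) = (hilbert_function (ideal_add1 J a) (d + e) +
                                hilbert_function (ideal_colon J a) d)%N.
Proof.
move=> idJ ha.
have idA := homog_ideal_add1 idJ ha; have idC := homog_ideal_colon idJ ha.
pose mula (f : dhomog n.+1 k d) : dhomog n.+1 k (d + e) :=
  DHomog (dhomogM (dhomog_is_dhomog f) ha).
have mula_lin : linear mula.
  by move=> c f g; apply: val_inj; rewrite /= mulrDl -scalerAl.
pose mulaL := GRing.isLinear.Build _ _ _ _ mula mula_lin.
pose mulaH : {linear dhomog n.+1 k d -> dhomog n.+1 k (d + e)} := HB.pack mula
  mulaL.
pose phi := linfun mulaH.
have phiE f : mpoly_of_dhomog (phi f) = mpoly_of_dhomog f * a by rewrite lfunE.
set UJ := graded_piece J (d + e).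
(* Taking components of degree [d + e] in [f1 + g * a] shows that this part of [J + (a)] is that of
   [J] plus the image of [phi]. *)
have -> : hilbert_function (ideal_add1 J a) (d + e) =
    (\dim (fullv : {vspace dhomog n.+1 k (d + e)}) - \dim (UJ + limg phi))%N.
  congr (_ - \dim _)%N; apply/vspaceP => f; rewrite graded_pieceE //.
  apply/idP/idP=> [/asboolP[f1 [g [f1J fE]]]|/memv_addP[f1 f1J [_ /memv_imgP[g _
    ->] ->]]].
    have {}fE : mpoly_of_dhomog f = pihomog mdeg (d + e) f1 + pihomog mdeg d g *
      a.
      rewrite -(pihomogM_ge _ _ ha) -pihomogD -fE pihomog_dE //;
        exact: (dhomog_is_dhomog f).
    apply/memv_addP; exists (DHomog (pihomogP mdeg (d + e) f1)).
      by rewrite graded_pieceE //=; case: idJ => _ _ _; apply.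
    exists (phi (DHomog (pihomogP mdeg d g))); first exact/memv_img/memvf.
    by apply: val_inj; rewrite linearD /= phiE.
  apply/asboolP; exists f1, g; split; last by rewrite linearD /= phiE.
  by rewrite graded_pieceE in f1J.
(* [phi] maps [J : a] onto the part of [J] in its image, and its kernel lies in [J : a]; the rest is
   the rank formula. *)
have cE : (phi @: graded_piece (ideal_colon J a) d = UJ :&: limg phi)%VS.
  apply/vspaceP => f; rewrite memv_cap graded_pieceE //; apply/memv_imgP/andP.
    move=> [g]; rewrite graded_pieceE // inE -phiE => gJ ->; split=> //.
    exact/memv_img/memvf.
  move=> [fJ /memv_imgP[g _ fE]]; exists g => //.
  by rewrite graded_pieceE // inE -phiE -fE.
have kE : (graded_piece (ideal_colon J a) d :&: lker phi = lker phi)%VS.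
  apply/capv_idPr/subvP => f; rewrite memv_ker graded_pieceE // inE -phiE =>
    /eqP->.
  by rewrite linear0; case: idJ.
have arith (V W U s l i c m : nat) : (c <= W -> U <= V -> s <= V ->
  s + m = U + i -> l + i = W -> l + m = c -> V - U = V - s + (W - c))%N by lia.
have := limg_ker_dim phi (graded_piece (ideal_colon J a) d).
have := limg_ker_dim phi fullv; rewrite capfv kE cE.
have := dimv_sum_cap UJ (limg phi).
have := dimvS (subvf (UJ + limg phi)); have := dimvS (subvf UJ).
have := dimvS (subvf (graded_piece (ideal_colon J a) d)).
exact: arith.
Qed.

(** * Homogeneous primes and prime filtrations *)

Lemma homog_ideal_pt x : homog_ideal (x : {pred R}).
Proof.
split; [exact: idealr0|by move=> f g; apply: rpredD|by move=> f g;
  apply: idealMr|].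
exact: (pt_homog (p := x)).
Qed.

Lemma pihomog_ge_msize d (f : R) : (msize f <= d)%N -> pihomog mdeg d f = 0.
Proof.
move=> fd; rewrite pihomogE big_seq_cond big1 // =>
  m /andP[/msize_mdeg_lt lt /eqP md].
by have := leq_trans lt fd; rewrite (md : mdeg m = d) ltnn.
Qed.

Lemma pihomogM_top d e (f g : R) : (msize f <= d.+1)%N -> (msize g <= e.+1)%N ->
  pihomog mdeg (d + e) (f * g) = pihomog mdeg d f * pihomog mdeg e g.
Proof.
move=> fd ge; rewrite {1}(pihomog_partitionE (mf := mdeg) fd) mulr_suml
  raddf_sum /=.
have ge_i i : (i <= d)%N ->
    pihomog mdeg (d + e) (pihomog mdeg i f * g) = pihomog mdeg i f * pihomog
      mdeg (d - i + e) g.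
  move=> id; have -> : (d + e = (d - i + e) + i)%N by lia.
  by rewrite mulrC (pihomogM_ge _ _ (pihomogP _ _ _)) mulrC.
rewrite big_ord_recr big1 /= => [|i _].
  by rewrite add0r ge_i // subnn.
have id := ltn_ord i; rewrite ge_i; last lia.
by rewrite (@pihomog_ge_msize _ g) ?mulr0 //; apply: leq_trans ge _; lia.
Qed.

Lemma msize_sub_pihomog d (f : R) : (msize f <= d.+1)%N ->
  (msize (f - pihomog mdeg d f) <= d)%N.
Proof.
move=> fd; rewrite {1}(pihomog_partitionE (mf := mdeg) fd) big_ord_recr /=
  addrK.
apply: (big_ind (fun h : R => msize h <= d)%N) => [|u v ud vd|i _].
- by rewrite msize0.
- by apply: leq_trans (msizeD_le _ _) _; rewrite geq_max ud.
- apply: leq_trans (ltn_ord i); rewrite leqNgt; apply/negP => lt.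
  have nz : pihomog mdeg i f != 0 by rewrite -msize_poly_eq0; lia.
  have mi : mdeg (mlead (pihomog mdeg i f)) = i.
    by have /dhomogP/(_ _ (mlead_supp nz)) := pihomogP mdeg i f.
  by move: lt; rewrite -(mlead_deg nz) mi ltnn.
Qed.

(** The top component of [f * g] is the product of the top components, so one of these lies in [J];
    subtracting it lowers a degree bound, and induction on the sum of the bounds applies. *)
Lemma homog_prime J : homog_ideal J ->
  (forall d e f g, f \is homogeneous d -> g \is homogeneous e ->
     f * g \in J -> (f \in J) || (g \in J)) ->
  prime_idealr_closed J.
Proof.
move=> [J0 JD JM JH] hprime f g.
suff: forall N d e f g, (d + e = N)%N -> (msize f <= d)%N -> (msize g <= e)%N ->
    f * g \in J -> (f \in J) || (g \in J).
  by move/(_ _ (msize f) (msize g) f g erefl); apply.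
have JB u v : u \in J -> v \in J -> u - v \in J.
  by move=> uJ vJ; apply: JD => //; rewrite -mulN1r; apply: JM.
elim=> [|N ih] [|d] [|e] {}f {}g //= => [_|_|_|].
- by rewrite leqn0 msize_poly_eq0 => /eqP->; rewrite J0.
- by rewrite leqn0 msize_poly_eq0 => /eqP->; rewrite J0.
- by move=> _; rewrite leqn0 msize_poly_eq0 => /eqP->; rewrite J0 orbT.
move=> [deN] fd ge fgJ.
have := JH (d + e)%N _ fgJ; rewrite pihomogM_top // =>
  /(hprime d e)-/(_ (pihomogP _ _ _) (pihomogP _ _ _)).
case/orP=> tJ.
  have := ih d e.+1 (f - pihomog mdeg d f) g deN (msize_sub_pihomog fd) ge.
  rewrite mulrBl JB //; last by rewrite mulrC; apply: JM.
  by case/(_ isT)/orP => [fJ|->]; rewrite ?orbT // -[f](subrK (pihomog mdeg d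
    f)) JD.
have := ih d.+1 e f (g - pihomog mdeg e g).
rewrite mulrBr JB //; last by apply: JM.
case/(_ _ fd (msize_sub_pihomog ge) isT)/orP => [|->|gJ]; rewrite ?orbT //;
  first lia.
by rewrite -[g](subrK (pihomog mdeg e g)) JD ?orbT.
Qed.

Lemma proj_pt_of_prime J : homog_ideal J -> 1 \notin J ->
  prime_idealr_closed J ->
  (exists i : 'I_n.+1, mpolyX k (mnm1 i) \notin J) ->
  exists x : proj_pt k n, (x : {pred R}) =i J.
Proof.
move=> [J0 JD JM JH] nJ1 Jprime Jrel.
have Jid : idealr_closed J by split=> // a u v uJ vJ; apply: JD => //;
  apply: JM.
pose m1 := isIdealr.Build _ J Jid.
pose m2 := isPrimeIdealrClosed.Build _ J Jprime.
pose P : prime_idealr R := HB.pack (J : R -> bool) m1 m2.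
by exists (@ProjPt k n P JH Jrel).
Qed.

Lemma mpolyX_irrelevant J (m : multinom n.+1) : homog_ideal J ->
  (forall i : 'I_n.+1, mpolyX k (mnm1 i) \in J) -> (0 < mdeg m)%N ->
    mpolyX k m \in J.
Proof.
move=> [_ _ JM _] XJ m0.
have [i mi] : exists i, m i != 0%N.
  apply: contrapT => nm; move: m0; rewrite mdegE big1 // => i _.
  by apply/eqP/negPn/negP => mi; apply: nm; exists i.
by rewrite -(submK (m := mnm1 i) (m' := m)) ?lep1mP // mpolyXD; apply: JM.
Qed.

Lemma homog_irrelevant J d f : homog_ideal J ->
  (forall i : 'I_n.+1, mpolyX k (mnm1 i) \in J) -> (0 < d)%N ->
  f \is homogeneous d -> f \in J.
Proof.
move=> idJ XJ d0 /dhomogP fd; case: (idJ) => J0 JD JM _.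
rewrite [f]mpolyE big_seq; apply: (big_ind (fun h => h \in J)) => // m mf.
rewrite -mul_mpolyC; apply: JM; apply: mpolyX_irrelevant => //.
by rewrite (fd m mf).
Qed.

Lemma hilbert_function_full J d : homog_ideal J ->
  (forall f, f \is homogeneous d -> f \in J) -> hilbert_function J d = 0%N.
Proof.
move=> idJ fJ; rewrite /hilbert_function.
suff -> : graded_piece J d = fullv by rewrite subnn.
apply/vspaceP => f; rewrite graded_pieceE // memvf fJ //.
exact: (dhomog_is_dhomog f).
Qed.

(* A prime filtration of R/J with factors (R/p)(-d), (p, d) in s, up to factors
   of finite length. *)
Lemma devissage J : homog_ideal J -> exists s : seq (proj_pt k n * nat),
  [/\ forall pd, pd \in s -> zeros J pd.1,
      forall x, zeros J x -> exists2 pd, pd \in s & {subset (pd.1 : {pred R}) <=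
        (x : {pred R})} &
      exists d0, forall d, (d0 <= d)%N ->
        hilbert_function J d = (\sum_(pd <- s) hilbert_function (pd.1 : {pred
          R}) (d - pd.2))%N].
Proof.
move: J; apply: homog_ideal_noetherian => J idJ IH; case: (idJ) => J0 JD JM JH.
have [J1|nJ1] := boolP (1 \in J).
  exists [::]; split=> // [x /(_ _ J1)|]; first by rewrite idealr1.
  exists 0%N => d _; rewrite big_nil hilbert_function_full // => f _.
  by rewrite -[f]mulr1; apply: JM.
have [[[[d e] [a b]] [/= ha hb abJ]]|nab] := pselect (exists abde : (nat * nat)
  * (R * R),
    [/\ abde.2.1 \is homogeneous abde.1.1, abde.2.2 \is homogeneous abde.1.2,
        abde.2.1 * abde.2.2 \in J & ~~ ((abde.2.1 \in J) || (abde.2.2 \in J))]);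
          last first.
  have Jprime : prime_idealr_closed J.
    apply: homog_prime => // d e f g fd ge fgJ; apply/negPn/negP => nfg.
    by apply: nab; exists ((d, e), (f, g)).
  have [Jrel|nJrel] := pselect (exists i : 'I_n.+1, mpolyX k (mnm1 i) \notin J).
    have [x xJ] := proj_pt_of_prime idJ nJ1 Jprime Jrel.
    exists [:: (x, 0%N)]; split=> [pd|y Jy|].
    - by rewrite inE => /eqP-> f; rewrite /= xJ.
    - by exists (x, 0%N); [rewrite inE|move=> f; rewrite /= xJ; apply: Jy].
    exists 0%N => d _; rewrite big_seq1 subn0 /=.
    apply/eqP; rewrite eqn_leq !hilbert_function_subset //;
      try exact: homog_ideal_pt.
    + by move=> f; rewrite xJ.
    + by move=> f; rewrite xJ.
  (* A prime that contains all variables contains all forms of positive degree, so the empty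
     filtration is correct from degree [1] on. *)
  have XJ (i : 'I_n.+1) : mpolyX k (mnm1 i) \in J.
    by apply/negPn/negP => nX; apply: nJrel; exists i.
  exists [::]; split=> // [x Jx|].
    by case: (pt_relevant x) => i; rewrite Jx.
  exists 1%N => d d0; rewrite big_nil hilbert_function_full // => f.
  exact: homog_irrelevant.
rewrite negb_or => /andP[naJ nbJ].
(* [J + (a)] gains [a] and [J : a] gains [b], so both are strictly larger than [J] and the induction
   applies to them. *)
have idA := homog_ideal_add1 idJ ha; have idC := homog_ideal_colon idJ ha.
have JA : {subset J <= ideal_add1 J a}.
  by move=> f fJ; apply/asboolP; exists f, 0; rewrite mul0r addr0.
have JC : {subset J <= ideal_colon J a} by move=> f fJ; rewrite inE mulrC;
  apply: JM.
have aA : a \in ideal_add1 J a by apply/asboolP; exists 0, 1;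
  rewrite mul1r add0r.
have bC : b \in ideal_colon J a by rewrite inE mulrC.
have [sA [sA1 sA2 [dA HA]]] := IH _ idA JA (fun s => negP naJ (s _ aA)).
have [sC [sC1 sC2 [dC HC]]] := IH _ idC JC (fun s => negP nbJ (s _ bC)).
(* [J : a] enters through multiplication by [a], whence the shift of its factors by the degree [d]
   of [a]. *)
exists (sA ++ [seq (pd.1, (pd.2 + d)%N) | pd <- sC]); split.
- move=> pd; rewrite mem_cat => /orP[/sA1 h f /JA/h //|/mapP[pd' /sC1 h ->] f
    /JC/h //].
(* A prime containing [J] contains [J + (a)] if it contains [a], and [J : a] if it does not. *)
- move=> x Jx; have := Jx _ abJ; rewrite prime_idealrM => /orP[ax|bx].
    have [|pd pds pdx] := sA2 x; last by exists pd; rewrite ?mem_cat ?pds.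
    by move=> _ /asboolP[f [g [/Jx fx ->]]]; rewrite rpredD // idealMr.
  have [ax|nax] := boolP (a \in (x : {pred R})).
    have [|pd pds pdx] := sA2 x; last by exists pd; rewrite ?mem_cat ?pds.
    by move=> _ /asboolP[f [g [/Jx fx ->]]]; rewrite rpredD // idealMr.
  have [|pd pds pdx] := sC2 x.
    by move=> f; rewrite inE => /Jx; rewrite prime_idealrM (negbTE nax) orbF.
  exists (pd.1, (pd.2 + d)%N) => //; rewrite mem_cat; apply/orP; right.
  by apply/mapP; exists pd.
- exists (dA + dC + d)%N => i di; rewrite big_cat big_map /=.
  have [di1 di2 di3] : [/\ d <= i, dA <= i & dC <= i - d]%N by clear -di;
    split; lia.
  have := hilbert_function_add1 (i - d) idJ ha.
  rewrite (subnK di1) (HA _ di2) (HC _ di3) => ->.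
  by congr (_ + _)%N; apply: eq_bigr => pd _; rewrite addnC subnDA.
Qed.

Lemma scale_in_pt x c (f : R) : f \in (x : {pred R}) ->
  c *: f \in (x : {pred R}).
Proof. by rewrite -mul_mpolyC; apply: idealMr. Qed.

Lemma exp_in_pt x (a : R) i : a ^+ i \in (x : {pred R}) -> a \in (x : {pred R}).
Proof.
elim: i => [|i ih]; first by rewrite expr0 idealr1.
by rewrite exprS prime_idealrM => /orP[//|/ih].
Qed.

Lemma homogeneousX (i : 'I_n.+1) d : mpolyX k (mnm1 i) ^+ d \is homogeneous d.
Proof.
rewrite -[X in homogeneous X]mul1n; apply: dhomogMn.
by rewrite dhomogX; apply/eqP/mdeg1.
Qed.

Lemma exists_homogeneous_notin x d : exists2 a : R,
  a \is homogeneous d & a \notin (x : {pred R}).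
Proof.
have [i nXi] := pt_relevant x; exists (mpolyX k (mnm1 i) ^+ d).
  exact: homogeneousX.
by apply: contraNN nXi; apply: exp_in_pt.
Qed.

Lemma hilbert_function_pt_gt0 x d : (0 < hilbert_function (x : {pred R}) d)%N.
Proof.
have [a ha nax] := exists_homogeneous_notin x d.
rewrite subn_gt0 ltn_neqAle dimvS ?subvf // andbT; apply: contraNneq nax => dE.
have /eqP eU : graded_piece (x : {pred R}) d == fullv
  by rewrite eqEdim subvf dE /=.
have := memvf (DHomog ha); rewrite -eU graded_pieceE //; exact: homog_ideal_pt.
Qed.

(** As [x] is prime, [x : a] is [x] itself. *)
Lemma hilbert_function_pt_add1 x (a : R) d e : a \is homogeneous e ->
  a \notin (x : {pred R}) ->
  hilbert_function (x : {pred R}) (d + e) =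
  (hilbert_function (ideal_add1 x a) (d + e) + hilbert_function (x : {pred R})
    d)%N.
Proof.
move=> ha nax; rewrite (hilbert_function_add1 _ (homog_ideal_pt x) ha);
  congr addn.
apply/eqP; have idx := homog_ideal_pt x.
rewrite eqn_leq !hilbert_function_subset //; try exact: homog_ideal_colon ha.
  by move=> f; rewrite inE prime_idealrM (negbTE nax) orbF.
by move=> f fx; rewrite inE mulrC idealMr.
Qed.

Lemma hilbert_function_pt_mono x d e : (d <= e)%N ->
  (hilbert_function (x : {pred R}) d <= hilbert_function (x : {pred R}) e)%N.
Proof.
move/subnKC<-; have [a ha nax] := exists_homogeneous_notin x (e - d).
by rewrite (hilbert_function_pt_add1 _ ha nax) leq_addl.
Qed.

Lemma zeros_add1 J a x : homog_ideal J ->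
  zeros (ideal_add1 J a) x <-> zeros J x /\ a \in (x : {pred R}).
Proof.
move=> [J0 _ _ _]; split=> [Jx|[Jx ax] _ /asboolP[f [g [/Jx fx ->]]]].
  split=> [f fJ|]; apply: Jx; apply/asboolP.
    by exists f, 0; rewrite mul0r addr0.
  by exists 0, 1; rewrite mul1r add0r.
by rewrite rpredD // idealMr.
Qed.

(** Each prime of a filtration of [J] is a zero of [J], so the filtration is empty. *)
Lemma hilbert_function_empty J : homog_ideal J -> (forall x, ~ zeros J x) ->
  exists d0, forall d, (d0 <= d)%N -> hilbert_function J d = 0%N.
Proof.
move=> idJ nJ; have [s [sJ _ [d0 Hd]]] := devissage idJ.
exists d0 => d /Hd->; case: s sJ {Hd} => [|pd s] sJ; first by rewrite big_nil.
by case: (nJ pd.1); apply: sJ; rewrite inE eqxx.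
Qed.

(** * Closed points *)

Definition closed_pt x := forall y, zeros x y -> zeros y x.

(** The homogenization [a^N p(f/a)] of [p] in degree [N]; factors of [p] become factors of the
    form. *)
Definition binary_form (f a : R) N (p : {poly k}) : R :=
  \sum_(i < N.+1) p`_i *: (f ^+ i * a ^+ (N - i)).

Lemma binary_formXn f a N (p : {poly k}) : (size p <= N.+1)%N ->
  binary_form f a N.+1 p = a * binary_form f a N p.
Proof.
move=> sp; rewrite /binary_form big_ord_recr /= nth_default // scale0r addr0
  mulr_sumr.
apply: eq_bigr => i _; have -> : (N.+1 - i = (N - i).+1)%N
  by have := ltn_ord i; lia.
by rewrite -scalerAr exprS mulrCA.
Qed.

Lemma binary_formMX f a N (p : {poly k}) :
  binary_form f a N.+1 (p * 'X) = f * binary_form f a N p.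
Proof.
rewrite /binary_form big_ord_recl coefMX eqxx scale0r add0r mulr_sumr.
apply: eq_bigr => i _; rewrite coefMX /= -scalerAr mulrA -exprS.
by congr (_ *: (_ * _ ^+ _)).
Qed.

Lemma binary_formB f a N (p q : {poly k}) :
  binary_form f a N (p - q) = binary_form f a N p - binary_form f a N q.
Proof. by rewrite -sumrB; apply: eq_bigr => i _; rewrite coefB scalerBl. Qed.

Lemma binary_formZ f a N c (p : {poly k}) :
  binary_form f a N (c *: p) = c *: binary_form f a N p.
Proof. by rewrite scaler_sumr; apply: eq_bigr => i _;
  rewrite coefZ scalerA. Qed.

(** Each step splits off a factor [a] if [p] has degree below the formal one, and [f - r *: a] for a
    root [r] of [p] otherwise; the prime [x] avoids [a]. *)
Lemma binary_form_factor x f a N (p : {poly k}) : a \notin (x : {pred R}) ->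
  p != 0 -> (size p <= N.+1)%N -> binary_form f a N p \in (x : {pred R}) ->
  exists r, f - r *: a \in (x : {pred R}).
Proof.
move=> nax; elim: N p => [|N ih] p nz_p sp.
  rewrite /binary_form big_ord1 subn0 !expr0 mulr1 => px.
  have nz_c : p`_0 != 0.
    by apply: contraNneq nz_p => c0; rewrite [p]size1_polyC // c0.
  have := scale_in_pt (p`_0)^-1 px.
  by rewrite scalerA mulVf // scale1r idealr1.
have [sp'|sp'] := leqP (size p) N.+1.
  by rewrite binary_formXn // prime_idealrM (negbTE nax) => /ih; apply.
have /closed_rootP[r /factor_theorem[q pE]] : size p != 1%N by lia.
have nz_q : q != 0 by apply: contraNneq nz_p => q0; rewrite pE q0 mul0r.
have sq : (size q <= N.+1)%N.
  by move: sp; rewrite pE size_Mmonic ?monicXsubC // size_XsubC addn2.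
rewrite pE mulrBr [q * r%:P]mulrC mul_polyC binary_formB binary_formMX
  binary_formZ.
rewrite (binary_formXn _ _ sq) scalerAl -mulrBl prime_idealrM => /orP[fx|/ih];
  last exact.
by exists r.
Qed.

(** The preimage of [U] in the space of coefficients has codimension at most [N], hence is
    nonzero. *)
Lemma lin_dep_mod (V : vectType k) (U : {vspace V}) N (w : 'I_N.+1 -> V) :
  (\dim (fullv : {vspace V}) - \dim U <= N)%N ->
  exists2 c : 'rV[k]_N.+1, c != 0 & \sum_i c 0 i *: w i \in U.
Proof.
move=> codimU; pose s (c : 'rV[k]_N.+1) := \sum_i c 0 i *: w i.
have s_lin : linear s.
  move=> a c c'; rewrite /s scaler_sumr -big_split; apply: eq_bigr => i _ /=.
  by rewrite !mxE scalerDl scalerA.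
pose sL := GRing.isLinear.Build _ _ _ _ s s_lin.
pose sH : {linear 'rV[k]_N.+1 -> V} := HB.pack s sL.
pose phi := linfun sH.
have kE : ((phi @^-1: U) :&: lker phi = lker phi)%VS.
  by apply/capv_idPr; rewrite -lpreim0 lpreimS // sub0v.
have cE : (phi @: (phi @^-1: U) = U :&: limg phi)%VS.
  by rewrite -lpreim_cap_limg lpreimK // capvSr.
have := limg_ker_dim phi (phi @^-1: U); have := limg_ker_dim phi fullv.
rewrite capfv kE cE dimvf /dim /= => eq1 eq2.
have := dimv_sum_cap U (limg phi); have := dimvS (subvf (U + limg phi)%VS) =>
  eq3 eq4.
have : (0 < \dim (phi @^-1: U))%N by move: codimU eq1 eq2 eq3 eq4;
  rewrite mul1n; lia.
rewrite lt0n dimv_eq0 -vpick0 => nzc.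
exists (vpick (phi @^-1: U)) => //.
by have := memv_pick (phi @^-1: U); rewrite -memv_preim lfunE.
Qed.

(* The forms f^i a^(N-i) are linearly dependent modulo x for large N, and a
   binary form over k is a product of linear forms. *)
Lemma closed_pt_proportional x d (f a : R) : closed_pt x ->
  f \is homogeneous d -> a \is homogeneous d -> a \notin (x : {pred R}) ->
  exists r, f - r *: a \in (x : {pred R}).
Proof.
move=> clx hf ha nax; have idx := homog_ideal_pt x.
(* As [x] is closed, [x + (a)] has no zero; its Hilbert function vanishes from [e0] on, so that of
   [x] is constant along steps of [d]. *)
have [|e0 He0] := hilbert_function_empty (homog_ideal_add1 idx ha).
  by move=> y /(zeros_add1 _ _ idx)[xy ay]; move/negP: nax; apply;
    apply: clx xy _ ay.
have hxd m : hilbert_function (x : {pred R}) (e0 + d * m) = hilbert_function (x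
  : {pred R}) e0.
  elim: m => [|m ih]; first by rewrite muln0 addn0.
  rewrite mulnS addnCA addnC (hilbert_function_pt_add1 _ ha nax) He0 ?ih //.
  by rewrite -addnA leq_addr.
(* By monotonicity this constant also bounds the Hilbert function in degree [d * N], where the
   [N + 1] forms [f^i a^(N-i)] live. *)
set N := hilbert_function (x : {pred R}) e0 in hxd.
have hN : (hilbert_function (x : {pred R}) (d * N) <= N)%N.
  by rewrite -[leqRHS](hxd N) hilbert_function_pt_mono // leq_addl.
have hw (i : 'I_N.+1) : f ^+ i * a ^+ (N - i) \is homogeneous (d * N).
  have -> : (d * N = d * i + d * (N - i))%N by rewrite -mulnDr subnKC // -ltnS.
  by apply: dhomogM; apply: dhomogMn.
have [c nzc] := lin_dep_mod (fun i => DHomog (hw i)) hN.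
rewrite graded_pieceE // linear_sum /= => cx.
pose p := \poly_(i < N.+1) c 0 (inord i).
apply: (@binary_form_factor x f a N p nax) => //.
- apply: contraNneq nzc => p0; apply/eqP/rowP => i.
  have := coef0 k i; rewrite -p0 coef_poly ltn_ord inord_val => ->.
  by rewrite mxE.
- exact: size_poly.
- rewrite /binary_form (eq_bigr (fun i : 'I_N.+1 =>
    c 0 i *: (f ^+ i * a ^+ (N - i)))) //.
  by move=> i _; rewrite coef_poly ltn_ord inord_val.
Qed.

Lemma hilbert_function_closed_pt x d : closed_pt x ->
  hilbert_function (x : {pred R}) d = 1%N.
Proof.
move=> clx; apply/eqP; rewrite eqn_leq hilbert_function_pt_gt0 andbT.
have [a ha nax] := exists_homogeneous_notin x d; have idx := homog_ideal_pt x.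
have le : (fullv <= graded_piece (x : {pred R}) d + <[DHomog ha]>)%VS.
  apply/subvP => f _.
  have [r fr] := closed_pt_proportional clx (dhomog_is_dhomog f) ha nax.
  have -> : f = (f - r *: DHomog ha) + r *: DHomog ha by rewrite subrK.
  by rewrite memv_add ?memvZ ?memv_line // graded_pieceE.
have := dimvS le; have := dimv_sum_cap (graded_piece (x : {pred R}) d) <[DHomog
  ha]>%VS.
rewrite dim_vline /hilbert_function; case: (_ != 0); lia.
Qed.

(** All primes of a filtration are closed points and contribute [1] each, so the constant is the
    number of factors. *)
Lemma hilbert_function_closed J : homog_ideal J -> (forall x, zeros J x ->
  closed_pt x) ->
  exists2 c, exists d0, forall d, (d0 <= d)%N -> hilbert_function J d = c &
    (exists x, zeros J x) -> (0 < c)%N.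
Proof.
move=> idJ clJ; have [s [sJ Js [d0 Hd]]] := devissage idJ.
exists (size s); last by move=> [x /Js[pd pds _]]; case: s pds {sJ Js Hd}.
exists d0 => d /Hd->; rewrite -sum1_size big_seq [RHS]big_seq.
by apply: eq_bigr => pd /sJ/clJ clpd; rewrite hilbert_function_closed_pt.
Qed.

Lemma poly_eq_large_nat (P Q : {poly rat}) d0 :
  (forall d, (d0 <= d)%N -> P.[d%:R] = Q.[d%:R]) -> P = Q.
Proof.
move=> PQ; apply/eqP; rewrite -subr_eq0; apply/eqP.
apply: (@roots_geq_poly_eq0 _ _ [seq i%:R | i <- iota d0 (size (P - Q))]).
- apply/allP => r /mapP[i]; rewrite mem_iota => /andP[d0i _] ->.
  by rewrite /root hornerD hornerN PQ // subrr.
- rewrite map_inj_uniq ?iota_uniq //; exact: (mulrIn (oner_neq0 _)).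
- by rewrite size_map size_iota.
Qed.

(** The Hilbert polynomial is the eventual constant value; it is unique because values at large
    integers determine a polynomial. *)
Lemma euler_char_closed J : homog_ideal J -> (forall x, zeros J x ->
  closed_pt x) ->
  0 <= euler_char J /\ ((exists x, zeros J x) -> 0 < euler_char J).
Proof.
move=> idJ clJ; have [c [d0 Hd] c_gt0] := hilbert_function_closed idJ clJ.
suff -> : euler_char J = c%:R.
  by split=> [|/c_gt0]; rewrite ?ler0n ?ltr0n.
rewrite /euler_char /hilbert_polynomial; case: xgetP =>
  [P _ [d1 HP]|/(_ c%:R%:P)[]]; last first.
  by exists d0 => d /Hd->; rewrite hornerC.
rewrite (@poly_eq_large_nat P c%:R%:P (d0 + d1)) ?hornerC // => d dd.
by rewrite hornerC HP ?Hd //; lia.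
Qed.

(** * Curves on a surface *)

(** Once the predicates agree, all other fields are proofs, including those packed in the
    [prime_idealr] structure. *)
Lemma proj_pt_eq x y : (x : {pred R}) =i y -> x = y.
Proof.
case: x y => [P hP rP] [Q hQ rQ] /= PQ.
suff eqPQ : P = Q.
  by move: hP rP; rewrite eqPQ => hP rP; congr ProjPt; apply: Prop_irrelevance.
move: PQ; clear; case: P Q => [P cP] [Q cQ] PQ.
have eqPQ : P = Q by apply: funext => f; apply: PQ.
subst P; congr PrimeIdealr.Pack.
case: cP cQ {PQ} => [[oP] [aP] [iP] [pP]] [[oQ] [aQ] [iQ] [pQ]].
by congr (PrimeIdealr.Class (GRing.isOppClosed.Axioms_ _ _)
  (GRing.isAddClosed.Axioms_ _ _) (isProperIdeal.Axioms_ _ _)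
  (isPrimeIdealrClosed.Axioms_ _ _)); apply: Prop_irrelevance.
Qed.

Lemma sub_varietyP x y : reflect (zeros x y /\ ~ zeros y x) (sub_variety x y).
Proof.
apply: (iffP (asboolP _)) => [[yx nxy]|[xy nyx]].
  split; first by apply: yx => f.
  by move=> yx'; apply: nxy => z xz f fy; apply/xz/yx'.
split=> [z yz f /xy/yz //|xy']; by apply: nyx; apply: xy' => f.
Qed.

Lemma not_closed_ptP x : ~ closed_pt x -> exists y, sub_variety x y.
Proof.
move=> ncl; apply: contrapT => ny; apply: ncl => y xy.
by apply: contrapT => nyx; apply: ny; exists y; apply/sub_varietyP.
Qed.

Lemma sub_variety_not_closed x y : sub_variety x y -> ~ closed_pt x.
Proof. by move/sub_varietyP => [xy nyx] /(_ y xy). Qed.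

Lemma zeros_trans y x z : zeros x y -> zeros y z -> zeros x z.
Proof. by move=> xy yz f /xy/yz. Qed.

Lemma homogeneous_separation x y : ~ zeros y x ->
  exists d (b : R), [/\ b \is homogeneous d,
    b \in (y : {pred R}) & b \notin (x : {pred R})].
Proof.
move=> nyx; apply: contrapT => nb; apply: nyx => f fy.
rewrite (pihomog_partitionE (mf := mdeg) (leqnn (mmeasure mdeg f))).
apply: rpred_sum => d _; apply/negPn/negP => nx; apply: nb.
by exists d, (pihomog mdeg d f); split; [exact: pihomogP|exact: pt_homog|].
Qed.

(** For [y] strictly above [x] and a form [b] of [y] outside of [x], the ideal [x + (b)] lies in
    [y], so each step by the degree of [b] adds at least [1]. *)
Lemma hilbert_function_unbounded x M : ~ closed_pt x ->
  exists d0, forall d, (d0 <= d)%N -> (M < hilbert_function (x : {pred R}) d)%N.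
Proof.
move=> /not_closed_ptP[y /sub_varietyP[xy nyx]].
have [e [b [hb by_ nbx]]] := homogeneous_separation nyx.
suff H m : (m < hilbert_function (x : {pred R}) (m * e))%N.
  by exists (M * e)%N => d /(hilbert_function_pt_mono x); apply: leq_trans.
elim: m => [|m ih]; first exact: hilbert_function_pt_gt0.
rewrite mulSn addnC (hilbert_function_pt_add1 _ hb nbx) -addn1 addnC.
apply: leq_add ih; apply: leq_trans (hilbert_function_pt_gt0 y (m * e + e)) _.
apply: hilbert_function_subset; [|exact: homog_ideal_pt|].
  exact: homog_ideal_add1 (homog_ideal_pt x) hb.
exact/(zeros_add1 b y (homog_ideal_pt x)).
Qed.

(** With no zero of [x + (a)], the Hilbert function of [x] would be eventually constant, against its
    unboundedness. *)
Lemma hyperplane_section_nonempty x (a : R) : ~ closed_pt x ->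
  a \is homogeneous 1 ->
  exists2 z, zeros x z & a \in (z : {pred R}).
Proof.
move=> nclx ha; have [ax|nax] := boolP (a \in (x : {pred R}));
  first by exists x.
apply: contrapT => nz; have idx := homog_ideal_pt x.
have [|d0 Hd] := hilbert_function_empty (homog_ideal_add1 idx ha).
  by move=> z /(zeros_add1 _ _ idx)[xz az]; apply: nz; exists z.
have hd m : hilbert_function (x : {pred R}) (d0 + m) = hilbert_function (x :
  {pred R}) d0.
  elim: m => [|m ih]; first by rewrite addn0.
  rewrite -[m.+1]addn1 addnA (hilbert_function_pt_add1 _ ha nax) Hd ?ih //.
  by rewrite -addnA leq_addr.
have [d1 /(_ (d0 + d1)%N (leq_addl _ _))] :=
  hilbert_function_unbounded (hilbert_function (x : {pred R}) d0) nclx.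
by rewrite hd ltnn.
Qed.

(** * Pencils of linear forms *)

Lemma fresh_scalar (s : seq k) : exists r, r \notin s.
Proof.
have [->|s0] := eqVneq s [::]; first by exists 0.
(* This polynomial takes the value [1] on [s], so its root is outside of [s]. *)
have /closed_rootP[r /eqP pr] : size (\prod_(c <- s) ('X - c%:P) + 1) != 1%N.
  rewrite size_polyDl size_prod_XsubC ?size_poly1 ?ltnS ?lt0n ?size_eq0 //.
  by rewrite eqSS size_eq0.
exists r; apply/negP => rs.
have /eqP r0 : root (\prod_(c <- s) ('X - c%:P)) r by rewrite root_prod_XsubC.
by move: pr; rewrite hornerD r0 hornerC add0r => /eqP; rewrite oner_eq0.
Qed.

Lemma pencil_member_unique x (a b : R) r r' : b \notin (x : {pred R}) ->
  a + r *: b \in (x : {pred R}) -> a + r' *: b \in (x : {pred R}) -> r = r'.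
Proof.
move=> nbx arx arx'; apply/eqP; rewrite -subr_eq0; apply: contraNT nbx => nz.
have : (a + r *: b) - (a + r' *: b) \in (x : {pred R}) by rewrite rpredB.
rewrite opprD addrACA subrr add0r -scalerBl => /(scale_in_pt (r - r')^-1).
by rewrite scalerA mulVf // scale1r.
Qed.

(** Each point of [s] contains at most one member of the pencil, so only finitely many scalars are
    to be avoided. *)
Lemma pencil_generic_member (s : seq (proj_pt k n)) (a b : R) :
  (forall x, x \in s -> a \in (x : {pred R}) -> b \notin (x : {pred R})) ->
  exists r, forall x, x \in s -> a + r *: b \notin (x : {pred R}).
Proof.
move=> nab.
have /choice[bad Hbad] : forall x, exists r, x \in s ->
    forall r', a + r' *: b \in (x : {pred R}) -> r' = r.
  move=> x; have [bx|nbx] := boolP (b \in (x : {pred R})).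
    exists 0 => xs r' ar'; have := nab x xs.
    by rewrite -[a](addrK (r' *: b)) rpredB ?scale_in_pt // bx => /(_ isT).
  have [[r ar]|nr] := pselect (exists r, a + r *: b \in (x : {pred R})).
    by exists r => _ r' ar'; apply: pencil_member_unique ar' ar.
  by exists 0 => _ r' ar'; case: nr; exists r'.
have [r nr] := fresh_scalar [seq bad x | x <- s].
exists r => x xs; apply: contraNN nr => arx.
by rewrite (Hbad x xs r arx) map_f.
Qed.

Lemma linear_form_avoidance (s : seq (proj_pt k n)) : exists2 a : R,
  a \is homogeneous 1 & forall x, x \in s -> a \notin (x : {pred R}).
Proof.
elim: s => [|x s [a ha nas]]; first by exists 0; rewrite ?rpred0.
have [b hb nbx] := exists_homogeneous_notin x 1.
have [|r Hr] := @pencil_generic_member (x :: s) a b; last first.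
  by exists (a + r *: b) => //; rewrite rpredD ?rpredZ.
by move=> y; rewrite inE => /predU1P[->//|/nas/negPf->].
Qed.

Lemma homog_ideal_add I J : homog_ideal I -> homog_ideal J ->
  homog_ideal (ideal_add I J).
Proof.
move=> [I0 ID IM IH] [J0 JD JM JH]; split.
- by apply/asboolP; exists 0, 0; rewrite addr0.
- move=> _ _ /asboolP[f [g [fI gJ ->]]] /asboolP[f' [g' [fI' gJ' ->]]].
  by apply/asboolP; exists (f + f'), (g + g'); split;
    [exact: ID|exact: JD|rewrite addrACA].
- move=> c _ /asboolP[f [g [fI gJ ->]]]; apply/asboolP.
  by exists (c * f), (c * g); split; [exact: IM|exact: JM|rewrite mulrDr].
- move=> d _ /asboolP[f [g [fI gJ ->]]]; apply/asboolP.
  by exists (pihomog mdeg d f), (pihomog mdeg d g); split;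
    [exact: IH|exact: JH|rewrite pihomogD].
Qed.

Lemma zeros_add I J x : homog_ideal I -> homog_ideal J ->
  zeros (ideal_add I J) x <-> zeros I x /\ zeros J x.
Proof.
move=> [I0 _ _ _] [J0 _ _ _].
split=> [IJx|[Ix Jx] _ /asboolP[f [g [/Ix fx /Jx gx ->]]]]; last exact: rpredD.
split=> f fI; apply/IJx/asboolP; first by exists f, 0; rewrite addr0.
by exists 0, f; rewrite add0r.
Qed.

(** * Intersections of curves and hyperplane sections of the surface *)

Section Surface.
Variable S : surface k n.
Implicit Types C D E F : curve S.

Lemma surface_chain : exists x y, sub_variety S x /\ sub_variety x y.
Proof.
case: (surf_dim S) => -[[|x [|y [|z s]]] [Ss ss] _] //.
case/andP: Ss => Sx /andP[xy _].
by exists x, y.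
Qed.

Lemma surface_chain2_closed x y : sub_variety S x -> sub_variety x y ->
  closed_pt y.
Proof.
move=> Sx xy; apply: contrapT => /not_closed_ptP[z yz].
case: (surf_dim S) => _ /(_ [:: x; y; z]) /=; rewrite Sx xy yz.
by move/(_ isT).
Qed.

Lemma curve_not_closed C : ~ closed_pt C.
Proof.
case: (curve_dim C) => -[[|x [|y s]] [Cs ss] _] //; case/andP: Cs => Cx _.
exact: sub_variety_not_closed Cx.
Qed.

Lemma curve_sub_closed C x : sub_variety C x -> closed_pt x.
Proof.
move=> Cx; apply: contrapT => /not_closed_ptP[z xz].
case: (curve_dim C) => _ /(_ [:: x; z]) /=; rewrite Cx xz.
by move/(_ isT).
Qed.

Lemma curve_eq C D : (C : proj_pt k n) = D -> C = D.
Proof.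
case: C D => [x sx dx] [y sy dy] /= xy; subst y.
by congr Curve; apply: Prop_irrelevance.
Qed.

(** A curve properly contained in another would be a closed point, by dimension. *)
Lemma distinct_curves C D : C <> D -> ~ zeros C D.
Proof.
move=> nCD CD; have [DC|nDC] := pselect (zeros D C).
  apply: nCD; apply/curve_eq/proj_pt_eq => f.
  by apply/idP/idP; [apply: CD|apply: DC].
by apply: (@curve_not_closed D); apply: (@curve_sub_closed C);
  apply/sub_varietyP.
Qed.

(** Chains below [x] lengthen by one when [x] itself is put below [S], so the dimension [2] of [S]
    bounds that of [x] by [1]. *)
Lemma curve_of_pt x : sub_variety S x -> ~ closed_pt x -> exists C,
  C = x :> proj_pt k n.
Proof.
move=> Sx nclx; case/sub_varietyP: (Sx) => zSx _.
have subx : (variety x `<=` variety S)%classic by move=> z xz;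
  apply: zeros_trans xz.
have dimx : dimension_is x 1.
  split; first by have [y xy] := not_closed_ptP nclx; exists [:: y];
    rewrite /= xy.
  by move=> s xs; case: (surf_dim S) => _ /(_ (x :: s)) /=; rewrite Sx; apply.
by exists (Curve subx dimx).
Qed.

(** A common point lies strictly inside [C], hence is closed; the Euler characteristic is thus that
    of a finite scheme. *)
Lemma intersection_distinct_ge0 C D : C <> D -> 0 <= intersection C D /\
  ((exists x, zeros C x /\ zeros D x) -> 0 < intersection C D).
Proof.
move=> nCD; rewrite /intersection; case: eqP => // _.
have idC := homog_ideal_pt C; have idD := homog_ideal_pt D.
have [|le lt] := euler_char_closed (homog_ideal_add idC idD).
  move=> x /(zeros_add _ idC idD)[Cx Dx]; apply: (@curve_sub_closed C).
  apply/sub_varietyP; split=> // xC.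
  by apply: (@distinct_curves D C); [exact/nesym|exact: zeros_trans xC].
split=> // -[x CDx]; apply: lt; exists x; exact/(zeros_add _ idC idD).
Qed.

(* Otherwise S + (a) only has closed zeros, and the Hilbert function of S grows
   at most linearly, which is impossible as that of the second term of a chain
   is unbounded. *)
Lemma hyperplane_section_curve (a : R) : a \is homogeneous 1 ->
  a \notin (S : {pred R}) ->
  exists C, a \in (C : {pred R}).
Proof.
move=> ha naS; have idS := homog_ideal_pt S; apply: contrapT => nC.
have [|c [d0 Hd] _] := hilbert_function_closed (homog_ideal_add1 idS ha).
  move=> x /(zeros_add1 _ _ idS)[Sx ax]; apply: contrapT => nclx; apply: nC.
  have [|C Cx] := curve_of_pt _ nclx; last by exists C; rewrite Cx.
  by apply/sub_varietyP; split=> // /(_ _ ax); apply/negP.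
have hS d m : (d0 <= d)%N -> hilbert_function (S : {pred R}) (d + m) =
    (m * c + hilbert_function (S : {pred R}) d)%N.
  move=> dd; elim: m => [|m ih]; first by rewrite addn0.
  rewrite -[m.+1]addn1 addnA (hilbert_function_pt_add1 _ ha naS) Hd ?ih.
    by rewrite addn1 mulSn addnA.
  by rewrite (leq_trans dd) // -addnA leq_addr.
have [x [y [/sub_varietyP[Sx nxS] xy]]] := surface_chain.
have [e [b [hb bx nbS]]] := homogeneous_separation nxS.
have [d1 Hd1] := hilbert_function_unbounded (e * c) (sub_variety_not_closed xy).
have := hilbert_function_pt_add1 (d0 + d1) hb nbS;
  rewrite hS ?leq_addr // => /addIn eq.
(* Over [e] degrees the Hilbert function of [S] grows by [e * c], which is the value for [S + (b)];
   as [x] contains this ideal, its value is no larger. *)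
have : (hilbert_function (x : {pred R}) (d0 + d1 + e) <= e * c)%N.
  rewrite eq; apply: hilbert_function_subset; [|exact: homog_ideal_pt|].
    exact: homog_ideal_add1 hb.
  exact/zeros_add1.
by rewrite leqNgt Hd1 // -addnA addnCA leq_addr.
Qed.

(* The members of a pencil of hyperplane sections with finite base locus on S
   each have a component meeting the base locus. *)
Lemma curves_through_finite_set : exists L : seq (proj_pt k n),
  forall Cs : seq (curve S), exists F, F \notin Cs /\ exists2 q,
    q \in L & zeros F q.
Proof.
have idS := homog_ideal_pt S.
have [b hb nbS] := exists_homogeneous_notin S 1.
have idSb := homog_ideal_add1 idS hb.
have [s [sSb Ss _]] := devissage idSb.
(* [a] lies in no prime of the filtration of [S + (b)], so a base point ends a chain of length two
   from [S] and is closed. *)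
have [a ha nas] := linear_form_avoidance [seq pd.1 | pd <- s].
have idJ := homog_ideal_add1 idSb ha.
have zJ x : zeros (ideal_add1 (ideal_add1 S b) a) x <->
    [/\ zeros S x, b \in (x : {pred R}) & a \in (x : {pred R})].
  split=> [/(zeros_add1 _ _ idSb)[/(zeros_add1 _ _ idS)[Sx bx] ax]|[Sx bx ax]]
    //.
  apply/(zeros_add1 _ _ idSb); split=> //; exact/(zeros_add1 _ _ idS).
have clJ x : zeros (ideal_add1 (ideal_add1 S b) a) x -> closed_pt x.
  move=> /zJ[Sx bx ax].
  have [|pd pds pdx] := Ss x; first exact/(zeros_add1 _ _ idS).
  have /(zeros_add1 _ _ idS)[Spd bpd] := sSb _ pds.
  have napd : a \notin (pd.1 : {pred R}) by apply: nas; apply: map_f.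
  apply: (@surface_chain2_closed pd.1); apply/sub_varietyP; split=> //.
    by move=> /(_ _ bpd); apply/negP.
  by move=> /(_ _ ax); apply/negP.
(* The base locus is finite: each base point contains a prime of this filtration, itself a closed
   base point, so the two coincide. *)
have [sJ [sJz Js _]] := devissage idJ.
exists [seq pd.1 | pd <- sJ] => Cs.
have nabC C : a \in (C : {pred R}) -> b \notin (C : {pred R}).
  move=> aC; apply/negP => bC; apply: (@curve_not_closed C); apply/clJ/zJ;
    split=> //.
  by apply: (@curve_sub _ _ _ C) => f.
(* [a] and [b] do not both vanish on a curve, as base points are closed, nor on [S]; so some member
   contains neither [S] nor a curve of [Cs]. *)
have [|r Hr] := @pencil_generic_member ((S : proj_pt k n) :: [seq (C : proj_pt k
  n) | C <- Cs]) a b.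
  by move=> x; rewrite inE => /predU1P[->//|/mapP[C _ ->]]; apply: nabC.
have hr : a + r *: b \is homogeneous 1 by rewrite rpredD ?rpredZ.
have [|F rF] := hyperplane_section_curve hr; first by apply: Hr;
  rewrite inE eqxx.
exists F; split.
  apply/negP => FCs; have : a + r *: b \notin (F : {pred R}).
    by apply: Hr; rewrite inE; apply/orP; right; apply: map_f.
  by rewrite rF.
have [z Fz bz] := hyperplane_section_nonempty (@curve_not_closed F) hb.
have az : a \in (z : {pred R}).
  by rewrite -[a](addrK (r *: b)) rpredB ?scale_in_pt // Fz.
have [|pd pds pdz] := Js z.
  apply/zJ; split=> //; apply: zeros_trans Fz; exact: (@curve_sub _ _ _ F).
exists pd.1; first exact: map_f.
by apply: zeros_trans Fz _; apply: clJ pdz; apply: sJz.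
Qed.

(** Fix for each base point a curve outside of [Cs] through it, if any. A further curve [F], outside
    of [Cs] and of these finitely many, passes through a base point [q] and meets the curve fixed
    there. *)
Lemma exists_meeting_curves (Cs : seq (curve S)) :
  exists D E, [/\ D \notin Cs, E \notin Cs, D <> E & 0 < intersection D E].
Proof.
have [L HL] := curves_through_finite_set.
have [F0 _] := HL [::].
have /choice[D HD] : forall q, exists D, (exists2 D',
  D' \notin Cs & zeros D' q) ->
    D \notin Cs /\ zeros D q.
  move=> q; have [[D' nD' D'q]|nD'] := pselect (exists2 D',
    D' \notin Cs & zeros D' q).
    by exists D'.
  by exists F0.
have [F [nF [q qL Fq]]] := HL (Cs ++ [seq D q | q <- L]).
move: nF; rewrite mem_cat negb_or => /andP[nFCs nFL].
have [|nD Dq] := HD q; first by exists F.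
have nDF : D q <> F by move=> DF; move: nFL; rewrite -DF map_f.
exists (D q), F; split=> //.
by have [_] := intersection_distinct_ge0 nDF; apply; exists q.
Qed.

End Surface.

(** * Independence in the Neron-Severi group *)

(** When free families have no maximal size, [Zrank] is [+oo] and the bound is trivial. *)
Lemma Zrank_ge (A : zmodType) r (a : 'I_r -> A) : Zfree a ->
  (r%:Z%:E <= Zrank A)%E.
Proof.
move=> fa; rewrite /Zrank; case: xgetP => [_ _ [s [_ maxs] <-]|_];
  last exact: leey.
by rewrite lee_fin lez_nat; apply: maxs fa.
Qed.

Section NeronSeveri.
Variable S : surface k n.
Implicit Types C D E : curve S.

Definition divisor_of_curve C : divisor S := [freeg [:: (1%R, C)]].

Definition curve_class C : neron_severi S := \pi_(neron_severi S)%qT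
  (divisor_of_curve C).

Lemma divisor_dot_sum r (A : 'I_r -> curve S) (c : 'I_r -> int) E :
  divisor_dot (\sum_i divisor_of_curve (A i) *~ c i) E =
  \sum_i intersection (A i) E * (c i)%:~R.
Proof.
pose f : curve S -> zmodule rat := fun X => intersection X E.
pose fL := GRing.isZmodMorphism.Build (divisor S) (zmodule rat) (fglift f)
  (@lift_is_additive int (curve S) (zmodule rat) f).
pose F : {additive divisor S -> zmodule rat} := HB.pack (fglift f) fL.
rewrite -[LHS]/(F _) raddf_sum; apply: eq_bigr => i _.
rewrite raddfMz /= -[X in X *~ _]/(fglift f (divisor_of_curve (A i))) liftU
  scale1r.
by rewrite [RHS]mulrzr.
Qed.

(** A relation between the classes makes the combination of the [A i] numerically trivial, so it
    pairs to zero with every curve. *)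
Lemma Zfree_curve_class r (A : 'I_r -> curve S) :
  (forall c : 'I_r -> int, (forall E, \sum_i intersection (A i) E * (c i)%:~R =
    0) ->
     forall i, c i = 0) ->
  Zfree (fun i => curve_class (A i)).
Proof.
move=> indep c c0; apply: indep => E; rewrite -divisor_dot_sum.
suff /asboolP : \sum_i divisor_of_curve (A i) *~ c i \in @num_trivial k n S by
  apply.
rewrite -[X in X \in _]subr0 Quotient.idealrBE; apply/eqP.
rewrite !raddf0 raddf_sum -[RHS]c0; apply: eq_bigr => i _.
by rewrite raddfMz.
Qed.

Section Configuration.
Variables (r : nat) (C : 'I_r -> curve S).
Hypothesis negC : negative_configuration C.

Lemma negative_configuration_eq0 (v : 'I_r -> rat) :
  0 <= \sum_i \sum_j v i * v j * intersection (C i) (C j) -> forall i, v i = 0.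
Proof.
move=> v_ge0 i; case: negC => _ /(_ (\row_i v i)) neg.
have [/rowP/(_ i)|/neg] := eqVneq (\row_i v i) 0; first by rewrite !mxE.
suff -> : (\row_i v i *m intersection_matrix C *m (\row_i v i)^T) 0 0 =
    \sum_i \sum_j v i * v j * intersection (C i) (C j) by rewrite ltNge v_ge0.
rewrite exchange_big mxE; apply: eq_bigr => j _; rewrite !mxE mulr_suml.
by apply: eq_bigr => l _; rewrite !mxE mulrAC.
Qed.

(* Split v = p - m into positive and negative parts: m.m >= 0 as m.p >= 0 and
   m.D >= 0, so m = 0; then d D.E + p.E = 0 with nonnegative terms. *)
Lemma negative_configuration_indep D E (d : rat) (v : 'I_r -> rat) :
  (forall i, C i <> D) -> (forall i, C i <> E) -> 0 < intersection D E ->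
    0 <= d ->
  (forall X, d * intersection D X + \sum_i v i * intersection (C i) X = 0) ->
  d = 0 /\ forall i, v i = 0.
Proof.
move=> nD nE DE d0 rel.
pose p i := Num.max (v i) 0; pose m i := Num.max (- v i) 0.
have p0 i : 0 <= p i by rewrite le_max lexx orbT.
have m0 i : 0 <= m i by rewrite le_max lexx orbT.
have [vE pm] : (forall i, v i = p i - m i) /\ (forall i, p i * m i = 0).
  apply: all_and2 => i; rewrite /p /m; have [vi|/ltW vi] := leP 0 (v i).
    by rewrite (max_idPr _) ?oppr_le0 // subr0 mulr0.
  by rewrite (max_idPl _) ?oppr_ge0 // opprK add0r mul0r.
have D0 i : 0 <= intersection D (C i).
  by case: (intersection_distinct_ge0 (nesym (nD i))).
have C0 i j : i != j -> 0 <= intersection (C i) (C j).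
  move=> ij; case: negC => injC _.
  by case: (@intersection_distinct_ge0 _ (C i) (C j)) => // /injC/eqP;
    rewrite (negbTE ij).
have /negative_configuration_eq0 m_eq0 :
    0 <= \sum_i \sum_j m i * m j * intersection (C i) (C j).
  (* This is the sum over [j] of [m j] times the relation at [C j], with [v = p - m]. *)
  have -> : \sum_i \sum_j m i * m j * intersection (C i) (C j) =
      d * (\sum_j m j * intersection D (C j)) +
      \sum_i \sum_j p i * m j * intersection (C i) (C j).
    apply/eqP; rewrite eq_sym -subr_eq0; apply/eqP.
    rewrite -addrA -sumrB mulr_sumr.
    under [X in _ + X]eq_bigr => i _ do rewrite -sumrB.
    rewrite [X in _ + X]exchange_big -big_split /= big1 // => j _.
    rewrite -[RHS](mulr0 (m j)) -[in RHS](rel (C j)) mulrDr mulrCA;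
      congr (_ + _).
    by rewrite mulr_sumr; apply: eq_bigr => i _;
      rewrite vE !mulrA mulrBr mulrBl -!(mulrC (m j)).
  (* On the diagonal [p i * m i = 0], so the negative self-intersections do not enter. *)
  rewrite addr_ge0 ?mulr_ge0 ?sumr_ge0 // => i _; first exact: mulr_ge0.
  apply: sumr_ge0 => j _; have [->|ij] := eqVneq i j; first by rewrite pm mul0r.
  by rewrite !mulr_ge0 ?C0.
have vp i : v i = p i by rewrite vE m_eq0 subr0.
have E0 i : 0 <= intersection (C i) E.
  by case: (intersection_distinct_ge0 (nE i)).
have d_eq0 : d = 0.
  have : 0 <= \sum_i v i * intersection (C i) E.
    by apply: sumr_ge0 => i _; rewrite vp mulr_ge0.
  by rewrite -[X in 0 <= X](addKr (d * intersection D E)) rel addr0 oppr_ge0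
    pmulr_lle0 // => dle; apply/le_anti/andP.
split=> // i; apply: negative_configuration_eq0 => {i}.
rewrite exchange_big sumr_ge0 //= => j _.
have := rel (C j); rewrite d_eq0 mul0r add0r => relj.
rewrite (eq_bigr (fun i => v j * (v i * intersection (C i) (C j)))); last first.
  by move=> i _; rewrite mulrCA mulrA.
by rewrite -mulr_sumr relj mulr0.
Qed.

Lemma negative_configuration_rank : (r.+1%:Z%:E <= picard_number S)%E.
Proof.
have [D [E [nD nE DneqE DE]]] := exists_meeting_curves [seq C i | i <- enum
  'I_r].
have inC i : C i \in [seq C i | i <- enum 'I_r] by apply: map_f;
  rewrite mem_enum.
have CD i : C i <> D by move=> eq; move: nD; rewrite -eq inC.
have CE i : C i <> E by move=> eq; move: nE; rewrite -eq inC.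
pose A (i : 'I_r.+1) := oapp C D (unlift ord0 i).
apply: (@Zrank_ge _ _ (fun i => curve_class (A i)));
  apply: Zfree_curve_class => c rel.
have {}rel X : (c ord0)%:~R * intersection D X +
    \sum_i (c (fintype.lift ord0 i))%:~R * intersection (C i) X = 0 :> rat.
  rewrite -[RHS](rel X) big_ord_recl /A unlift_none /= [intersection D X *
    _]mulrC; congr (_ + _).
  by apply: eq_bigr => i _; rewrite liftK mulrC.
have [c0 c1] : ((c ord0)%:~R = 0 :> rat) /\
    forall i, (c (fintype.lift ord0 i))%:~R = 0 :> rat.
  (* Independence is proved for a nonnegative coefficient of [D]; for a negative one the relation is
     negated. *)
  have [c_ge0|c_le0] := leP 0 ((c ord0)%:~R : rat).
    exact: (negative_configuration_indep CD CE DE).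
  have [| |c0 c1] := @negative_configuration_indep D E (- (c ord0)%:~R)
    (fun i => - (c (fintype.lift ord0 i))%:~R) CD CE DE.
  - by rewrite oppr_ge0 ltW.
  - move=> X; rewrite -[RHS]oppr0 -[in RHS](rel X) opprD mulNr -sumrN;
      congr (_ + _).
    by apply: eq_bigr => i _; rewrite mulNr.
  by split=> [|i]; apply/eqP; rewrite -oppr_eq0; apply/eqP.
move=> i; apply/eqP; rewrite -(intr_eq0 rat); apply/eqP.
by case: (unliftP ord0 i) => [j ->|->].
Qed.

Lemma mc_le : (mc C <= r)%N.
Proof. by apply/bigmax_leqP => A _; rewrite -[leqRHS]card_ord max_card. Qed.

End Configuration.

End NeronSeveri.

(** * Maximal number of vertices *)

(** [x] is the generic point: a nonempty relatively open subset contains it, and a relatively closed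
    subset containing it is everything. *)
Lemma connected_variety x : connected (variety x).
Proof.
move=> B [y By] [U openU BU] [Z closedZ BZ].
have [J UJ] : zariski_open U := openU.
have [K ZK] : zariski_open (~` Z)%classic := closed_openC closedZ.
rewrite setCK in ZK.
have Bx : B x.
  rewrite BU; split; first by move=> f.
  apply: contrapT => nUx; move: By; rewrite BU => -[xy Uy].
  have : (~` U)%classic x by [].
  rewrite UJ => Jx; have : (~` U)%classic y by rewrite UJ => f /Jx/xy.
  exact.
move: (Bx); rewrite BZ ZK => -[_ Kx].
by apply/seteqP; split=> [z []//|z xz]; split=> // f /Kx/xz.
Qed.

Section MaxVertices.
Variable S : surface k n.
Implicit Types C : curve S.

Lemma mc_curve (C : 'I_1 -> curve S) : mc C = 1%N.
Proof.
apply/eqP; rewrite eqn_leq mc_le /=.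
have conn : `[< connected (\bigcup_(i in [set` finset.setTfor 'I_1]) variety (C
  i))%classic >].
  apply/asboolP; suff -> : (\bigcup_(i in [set` finset.setTfor 'I_1]) variety (C
    i))%classic =
      variety (C ord0) by apply: connected_variety.
  apply/seteqP; split=> [x [i _]|x Cx]; first by rewrite (ord1 i).
  by exists ord0 => //=; rewrite inE.
by apply: leq_trans (leq_bigmax_cond _ conn); rewrite cardsT card_ord.
Qed.

(** A positive [m] is not the default [0] of [xget], and an attained upper bound is unique. *)
Lemma mvP m : (0 < m)%N -> mv S = m <->
  (exists (r : nat) (C : 'I_r -> curve S), negative_configuration C /\
    m = mvN C) /\
  forall (r : nat) (C : 'I_r -> curve S), negative_configuration C ->
    (mvN C <= m)%N.
Proof.
move=> m_gt0; rewrite /mv; case: xgetP => [_ -> [ex ub]|nex]; split.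
- by move=> <-.
- move=> [[r [C [negC ->]]] ub']; case: ex => s [D [negD eqD]].
  by apply/eqP; rewrite eqn_leq ub // andbT eqD ub'.
- by move=> m0; rewrite -m0 in m_gt0.
- by move=> /nex.
Qed.

Lemma empty_configuration : exists C : 'I_0 -> curve S,
  negative_configuration C.
Proof.
have [D _] := exists_meeting_curves (Nil (curve S)); exists (fun _ => D).
by split=> [[]//|v]; rewrite thinmx0 eqxx.
Qed.

Lemma negative_curve_configuration C : negative_curve C ->
  negative_configuration (fun _ : 'I_1 => C).
Proof.
move=> negC; split=> [i j _|v]; first by rewrite (ord1 i) (ord1 j).
rewrite mxE big_ord1 !mxE big_ord1 !mxE mulrAC -expr2 => nz_v.
rewrite nmulr_llt0 // lt_neqAle sqr_ge0 eq_sym sqrf_eq0 andbT.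
by apply: contraNneq nz_v => v0; apply/eqP/rowP => i; rewrite (ord1 i) v0 mxE.
Qed.

Lemma configuration_negative_curve r (C : 'I_r -> curve S) i :
  negative_configuration C -> negative_curve (C i).
Proof.
(* The form takes the value [C_i^2] at the [i]-th unit vector. *)
case=> _ /(_ (delta_mx 0 i)); rewrite -rowE trmx_delta -colE !mxE; apply.
apply/eqP => /rowP/(_ i); rewrite !mxE !eqxx => /eqP; by rewrite oner_eq0.
Qed.

End MaxVertices.
End Surfaces.

Theorem theorem1p1 (k : closedFieldType) (n : nat) (S : surface k n) :
  (mv S = 3%N <-> picard_number S = 1%:E) /\
  (mv S = 4%N <->
     (1%:E < picard_number S)%E /\ ~ exists C : curve S, negative_curve C) /\
  ((exists C : curve S, negative_curve C) ->
     (mv S = 5%N <-> picard_number S = 2%:E)).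
Proof.
have [C0 neg0] := empty_configuration S.
have rank_ge1 : (1%:E <= picard_number S)%E := negative_configuration_rank neg0.
(* Moving the finite [1%:E] across is valid for infinite rank too, and brings the case split of
   [mvN] to the shape of the rank bound. *)
have lt_pic (r : nat) : ((r%:Z%:E < picard_number S - 1%:E) = (r.+1%:Z%:E <
  picard_number S))%E.
  by rewrite lteBrDr // -EFinD -addn1 PoszD.
have mc0 (C : 'I_0 -> curve S) : mc C = 0%N by apply/eqP; rewrite -leqn0 mc_le.
have mvN0 : mvN C0 = if (1%:E < picard_number S)%E then 4%N else 3%N.
  by rewrite /mvN mc0 lt_pic.
have mvN1 (C : curve S) : negative_curve C -> mvN (fun _ : 'I_1 => C) =
    if (2%:E < picard_number S)%E then 6%N else 5%N.
  by move=> _; rewrite /mvN mc_curve lt_pic; case: ifP.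
have rank_ge2 (C : curve S) : negative_curve C -> (2%:E <= picard_number S)%E.
  by move=> /negative_curve_configuration/negative_configuration_rank.
have mv3 : mv S = 3%N <-> picard_number S = 1%:E.
  rewrite mvP //; split=> [[_ /(_ _ _ neg0)]|rk1].
    rewrite mvN0; case: ltP => // rk_le1 _; by apply/le_anti; rewrite rk_le1.
  split=> [|r C negC]; first by exists 0%N, C0; rewrite mvN0 rk1 ltxx.
  (* With rank [1], the bound leaves only the empty configuration. *)
  have := negative_configuration_rank negC;
    rewrite rk1 lee_fin lez_nat ltnS leqn0 => /eqP r0.
  by subst r; rewrite /mvN mc0 lt_pic rk1 ltxx.
split=> //; split; first (split=> [mv4|[rk_gt1 noneg]]).
- have nneg : ~ exists C : curve S, negative_curve C.
    (* A single negative curve already gives the value [5] or [6]. *)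
    move=> [C negC]; case/mvP: mv4 => // _ /(_ _ _ (negative_curve_configuration
      negC)).
    by rewrite mvN1 //; case: ifP.
  split=> //; rewrite lt_neqAle rank_ge1 andbT; apply/eqP => rk1.
  by move/esym/mv3: rk1; rewrite mv4.
- apply/mvP => //; split=> [|r C negC]; first by exists 0%N, C0;
    rewrite mvN0 rk_gt1.
  case: r C negC => [|r] C negC; first by rewrite /mvN mc0; case: ifP.
  by case: noneg; exists (C ord0); apply: configuration_negative_curve.
move=> [C negC]; split=> [/mvP[//|_ /(_ _ _ (negative_curve_configuration
  negC))]|rk2].
  (* The value [6] is excluded, so the rank is at most [2]. *)
  rewrite mvN1 //; case: ltP => // rk_le2 _; by apply/le_anti;
    rewrite rk_le2 (rank_ge2 C).
apply/mvP => //; split=> [|r D negD].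
  exists 1%N, (fun _ => C); rewrite mvN1 // rk2 ltxx; split=> //.
  exact: negative_curve_configuration.
(* With rank [2] only [r = 0] and [r = 1] remain; the latter gives exactly [1 + 1 + 3]. *)
have := negative_configuration_rank negD; rewrite rk2 lee_fin lez_nat ltnS.
case: r D negD => [|[|//]] D negD _; first by rewrite /mvN mc0; case: ifP.
by rewrite /mvN mc_curve lt_pic rk2 ltxx.
Qed.
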